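(* Let $(\mathcal H,d)$ be a locally compact Hadamard space and let $p\in[1,\infty)$. Then the set of uniformly continuous functions mapping from $\Omega$ to $\mathcal H$ is dense in $L^p(\Omega,\mathcal H)$ (with respect to the metric $\mathrm d_p$).
   Context: $\Omega\subset\mathbb R^n$, $n\ge 2$, is an open, bounded, connected domain with Lipschitz boundary, equipped with the Euclidean distance and the Lebesgue measure. A Hadamard space is a complete geodesic metric space $(\mathcal H,d)$ that is CAT(0), i.e. for every geodesic triangle with vertices $p,q,r$ and points $x$ on the geodesic from $p$ to $r$ and $y$ on the geodesic from $q$ to $r$, one has $d(x,y)\le|\bar x-\bar y|$ for the corresponding points in the Euclidean comparison triangle. Measurability of $f:\Omega\to\mathcal H$ is with respect to Lebesgue measurable sets in $\Omega$ and the Borel $\sigma$-algebra of $\mathcal H$. For measurable $f,g:\Omega\to\mathcal H$ and $p\in[1,\infty)$, $\mathrm d_p(f,g):=\left(\int_\Omega d^p(f(\omega),g(\omega))\,\mathrm d\omega\right)^{1/p}$. $\mathcal L^p(\Omega,\mathcal H)$ is the set of measurable $f$ with $\mathrm d_p(f,a)<\infty$ for any constant mapping $\omega\mapsto a\in\mathcal H$, and $L^p(\Omega,\mathcal H)$ is the quotient of $\mathcal L^p(\Omega,\mathcal H)$ by the relation $f\sim g$ iff $\mathrm d_p(f,g)=0$, equipped with the metric $\mathrm d_p$. *)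

(* Defs.v *)
From HB Require Import structures.
From mathcomp Require Import all_boot all_order all_algebra.
From mathcomp Require Import all_classical all_reals all_analysis.

Set Implicit Arguments.
Unset Strict Implicit.
Unset Printing Implicit Defensive.

Import Order.TTheory GRing.Theory Num.Theory.
Import numFieldNormedType.Exports.

Local Open Scope classical_set_scope.
Local Open Scope ring_scope.

(* The norm that the library puts on 'rV[R]_n is the sup norm. It is only used
   through the topology and the bounded sets, which are the Euclidean ones; all
   distances in R^n below are edist. *)
Definition edist (R : realType) (n : nat) (x y : 'rV[R]_n) : R :=
  Num.sqrt (\sum_(i < n) (x 0 i - y 0 i) ^+ 2).

Section lebesgue_rV.
Variables (R : realType) (n : nat).
Local Notation V := 'rV[R]_n.

(* Half-open boxes ]a_1, b_1] x ... x ]a_n, b_n]. None is the empty box, which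
   is not of that form when n = 0. *)
Definition box (B : option (V * V)) : set V :=
  if B is Some (a, b) then [set x | forall i, a 0 i < x 0 i <= b 0 i]
  else set0.

Definition box_volume (B : option (V * V)) : R :=
  if B is Some (a, b) then \prod_(i < n) Num.max 0 (b 0 i - a 0 i) else 0.

Definition box_cover (A : set V) : set ((option (V * V))^nat) :=
  [set B | A `<=` \bigcup_k box (B k)].

Definition lebesgue_outer (A : set V) : \bar R :=
  ereal_inf [set (\sum_(k <oo) (box_volume (B k))%:E)%E | B in box_cover A].

Local Open Scope ereal_scope.

Let vol_ge0 B : 0 <= (box_volume B)%:E.
Proof.
case: B => [[a b]|]//=; rewrite lee_fin; apply: prodr_ge0 => i _.
by rewrite le_max lexx.
Qed.

Let lebesgue_outer_ge0 A : 0 <= lebesgue_outer A.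
Proof.
apply: le_ereal_inf_tmp => x [B AB <-{x}].
by apply: nneseries_ge0 => k _ _; exact: vol_ge0.
Qed.

Let lebesgue_outer0 : lebesgue_outer set0 = 0.
Proof.
apply/eqP; rewrite eq_le lebesgue_outer_ge0 andbT.
apply: ereal_inf_lbound; exists (fun=> None); first by [].
by rewrite eseries0.
Qed.

Let le_lebesgue_outer : {homo lebesgue_outer : A B / A `<=` B >-> A <= B}.
Proof.
move=> A B AB; apply/ereal_inf_le_tmp => x [C BC <-{x}].
by exists C => //; exact: subset_trans BC.
Qed.

Let lebesgue_outer_sigma_subadditive : sigma_subadditive lebesgue_outer.
Proof.
move=> A; have [[i ioo]|] := pselect (exists i, lebesgue_outer (A i) = +oo).
  rewrite (eseries_pinfty _ _ ioo) ?leey// => k _.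
  by rewrite -ltNye (lt_le_trans _ (lebesgue_outer_ge0 _)).
rewrite -forallNE => Aoo.
apply/lee_addgt0Pr => _/posnumP[e].
rewrite (le_trans _ (epsilon_trick _ _ _))//.
pose P k B := box_cover (A k) B /\
  \sum_(j <oo) (box_volume (B j))%:E
    <= lebesgue_outer (A k) + (e%:num / (2 ^ k.+1)%:R)%:E.
have [G PG] : {G & forall k, P k (G k)}.
  apply: (@choice _ _ P) => k.
  have finA : lebesgue_outer (A k) \is a fin_num.
    by rewrite ge0_fin_numE// ltey; apply/eqP.
  have ek : (0 < e%:num / (2 ^ k.+1)%:R :> R)%R by [].
  have [x [B AB <-] xS] := lb_ereal_inf_adherent ek finA.
  by exists B; split => //; exact/ltW.
pose v := (fun B => (box_volume B)%:E) \o uncurry G.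
have v_ge0 x : 0 <= v x by exact: vol_ge0.
apply: (@le_trans _ _ (\esum_(i in setT) v i)).
  apply: ereal_inf_lbound => /=.
  have /card_esym/ppcard_eqP[f] := card_nat2.
  exists (uncurry G \o f).
    apply: (@subset_trans _ (\bigcup_i \bigcup_k box (G i k))) => [t [i _]|].
      by move=> /((PG i).1) -[j _ ?]; exists i => //; exists j.
    move=> t [i _ [j _ Bijt]]; exists (f^-1%FUN (i, j)) => //=.
    by rewrite invK ?inE.
  rewrite -(esum_pred_image v _ xpredT) ?[fun=> _]set_true//.
  by rewrite image_eq.
rewrite (_ : esum _ _ = \sum_(i <oo) \sum_(j <oo) (box_volume (G i j))%:E); last first.
  pose J : nat -> set (nat * nat) := fun i => [set (i, j) | j in setT].
  rewrite (_ : setT = \bigcup_k J k); last first.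
    by rewrite predeqE => -[a b]; split => // _; exists a => //; exists b.
  rewrite esum_bigcupT /=; last 2 first.
    - apply/trivIsetP => i j _ _ ij.
      rewrite predeqE => -[k m] /=; split => //= -[] [_] _ [<-{k} _].
      by move=> [m' _] [] /esym/eqP; rewrite (negbTE ij).
    - by [].
  rewrite -(image_id [set: nat]) -fun_true esum_pred_image//; last first.
    by move=> k _; exact: esum_ge0.
  apply: eq_eseriesr => /= j _.
  rewrite -(esum_pred_image v (pair j) predT)//=; last first.
    by move=> ? ? _ _; exact: (@can_inj _ _ _ snd).
  by congr esum; rewrite predeqE => -[a b]; split; move=> [i _ <-]; exists i.
by apply: lee_nneseries => [k _ _|k _]; [exact: nneseries_ge0|exact: (PG k).2].
Qed.

HB.instance Definition _ := isOuterMeasure.Build R V lebesgue_outer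
  lebesgue_outer0 lebesgue_outer_ge0 le_lebesgue_outer
  lebesgue_outer_sigma_subadditive.

(* The Caratheodory sigma-algebra of lebesgue_outer consists of the Lebesgue
   measurable sets, not only of the Borel ones. *)
Definition lebesgue_space := caratheodory_type lebesgue_outer.

HB.instance Definition _ := Measurable.on lebesgue_space.

Definition lebesgue_measure_rV : set lebesgue_space -> \bar R := lebesgue_outer.

HB.instance Definition _ := isMeasure.Build _ _ _ lebesgue_measure_rV
  (@caratheodory_measure0 R V lebesgue_outer)
  (@caratheodory_measure_ge0 R V lebesgue_outer)
  (@caratheodory_measure_sigma_additive R V lebesgue_outer).

End lebesgue_rV.

(* Near every boundary point, and up to an orthogonal change Q of coordinates,
   Omega is the strict epigraph, in the direction of the i-th coordinate, of a
   Lipschitz function of the n - 1 other coordinates. *)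
Definition lipschitz_boundary (R : realType) (n : nat) (Omega : set 'rV[R]_n) :=
  forall z, (closure Omega `\` interior Omega) z ->
    exists (r : R) (Q : 'M[R]_n) (i : 'I_n) (gamma : 'rV[R]_n.-1 -> R) (L : R),
      [/\ 0 < r,
          Q *m Q^T = 1%:M,
          forall u v, `|gamma u - gamma v| <= L * edist u v
        & forall y, edist z y < r ->
            (Omega y <-> gamma (col' i (y *m Q)) < (y *m Q) 0 i)].

#[short(type="completeMetricType")]
HB.structure Definition CompleteMetric (R : numFieldType) :=
  {T of Metric R T & Complete T}.

Section hadamard.
Variables (R : realType) (H : metricType R).

(* geodesics are parametrized proportionally to arc length on [0, 1] *)
Definition geodesic (x y : H) (c : R -> H) :=
  [/\ c 0 = x, c 1 = y &
      forall s t, 0 <= s <= 1 -> 0 <= t <= 1 ->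
        mdist (c s) (c t) = `|s - t| * mdist x y].

Definition geodesic_space := forall x y : H, exists c, geodesic x y c.

Definition geodesic_triangle (p q r : H) (cpq cpr cqr : R -> H) :=
  [/\ geodesic p q cpq, geodesic p r cpr & geodesic q r cqr].

Definition comparison_triangle (p q r : H) (p' q' r' : 'rV[R]_2) :=
  [/\ edist p' q' = mdist p q, edist p' r' = mdist p r
    & edist q' r' = mdist q r].

(* the points of the comparison triangle corresponding to cpr s and cqr t are
   those that divide its sides in the same ratios *)
Definition CAT0 :=
  forall p q r cpq cpr cqr, geodesic_triangle p q r cpq cpr cqr ->
  forall p' q' r', comparison_triangle p q r p' q' r' ->
  forall s t, 0 <= s <= 1 -> 0 <= t <= 1 ->
    mdist (cpr s) (cqr t)
    <= edist ((1 - s) *: p' + s *: r') ((1 - t) *: q' + t *: r').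

End hadamard.

Definition hadamard_space (R : realType) (H : completeMetricType R) :=
  geodesic_space H /\ CAT0 H.

(* Maps from Omega to H are represented by maps defined on the whole of R^n,
   whose values outside Omega play no role. *)
Section Lp.
Variables (R : realType) (n : nat) (H : completeMetricType R).
Variables (p : R) (Omega : set 'rV[R]_n).
Local Notation map := ('rV[R]_n -> H).

Definition borel_measurable (f : map) :=
  measurable_fun (Omega : set (lebesgue_space R n))
    (f : lebesgue_space R n -> g_sigma_algebraType (@open H)).

Definition dp (f g : map) : \bar R :=
  ((\int[@lebesgue_measure_rV R n]_(x in Omega) (mdist (f x) (g x) `^ p)%:E)
     `^ p^-1)%E.

Definition calLp : set map :=
  [set f | borel_measurable f /\ forall a : H, (dp f (fun=> a) < +oo)%E].

Definition Lp_class (f : map) : set map := [set g | calLp g /\ dp f g = 0%E].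

Definition Lp : set (set map) := [set Lp_class f | f in calLp].

(* Open ball of L^p for the metric induced by dp, whose value at two classes is
   that of dp at any representatives. *)
Definition Lp_ball (F : set map) (e : R) : set (set map) :=
  [set G | Lp G /\ forall f g, F f -> G g -> (dp f g < e%:E)%E].

Definition dense_in_Lp (S : set map) :=
  S `<=` calLp /\
  forall F, Lp F -> forall e : R, 0 < e ->
    Lp_ball F e `&` [set Lp_class g | g in S] !=set0.

Definition unif_continuous_on : set map :=
  [set g | forall e : R, 0 < e -> exists2 d : R, 0 < d &
     forall x y, Omega x -> Omega y -> edist x y < d -> mdist (g x) (g y) < e].

End Lp.

(* Main.v *)
Require Import Defs.
From mathcomp Require Import all_boot all_order all_algebra.
From mathcomp Require Import all_classical all_reals all_analysis.
From mathcomp Require Import measurable_realfun ring lra.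

Import Order.TTheory GRing.Theory Num.Theory.
Import numFieldNormedType.Exports.

(** A locally compact geodesic space is separable, so a map [f] of [L^p] is close
    to a map with finitely many values [d 0, ..., d N], where [f] is sent to
    [d 0] on a set [B] over which the integral of [d(f, d 0)^p] is small.
    Geodesics join these values into a Lipschitz curve [gamma] in [H] with
    [gamma i = d i], so the simple map is [gamma] composed with a simple function
    valued in [{0, ..., N}]. Indicators of measurable sets agree with Lipschitz
    functions outside sets of small measure (clear for half-spaces, hence for
    boxes and countable unions of boxes, hence for all sets by the definition of
    the outer measure). Replacing the indicators gives a Lipschitz function [phi],
    and [gamma \o phi] is uniformly continuous. It differs from the simple map only
    on a small set, and its distance to [d 0] has a bound that depends only on
    [gamma]. *)

Local Open Scope classical_set_scope.
Local Open Scope ring_scope.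

(* all_analysis has an edist of its own, the extended distance of a
   pseudometric space. *)
Local Notation edist := Defs.edist.

(** * Truncation to the unit interval *)

Section clamp.
Context {R : realFieldType}.
Implicit Types a b c d s t : R.

Lemma ler_dist_max a b c d :
  `|Num.max a b - Num.max c d| <= `|a - c| + `|b - d|.
Proof.
have := ler_norm (a - c); have := ler_norm (c - a).
have := ler_norm (b - d); have := ler_norm (d - b).
rewrite (distrC c) (distrC d) => *.
by rewrite ler_norml; case: (leP a b); case: (leP c d) => *;
  apply/andP; split; lra.
Qed.

Lemma ler_dist_min a b c d :
  `|Num.min a b - Num.min c d| <= `|a - c| + `|b - d|.
Proof.
have := ler_norm (a - c); have := ler_norm (c - a).
have := ler_norm (b - d); have := ler_norm (d - b).
rewrite (distrC c) (distrC d) => *.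
by rewrite ler_norml; case: (leP a b); case: (leP c d) => *;
  apply/andP; split; lra.
Qed.

(** The projection of the line onto [[0, 1]]: composed with it, a geodesic becomes a curve on the
    whole line, and an affine ramp becomes an approximate indicator. *)
Definition clamp t := Num.max 0 (Num.min 1 t).

Lemma clamp01 t : 0 <= clamp t <= 1.
Proof. by rewrite /clamp le_max lexx /= ge_max ler01 ge_min lexx. Qed.

Lemma clamp_eq0 t : t <= 0 -> clamp t = 0.
Proof.
by move=> t0; apply/max_idPl; rewrite (le_trans _ t0)// ge_min lexx orbT.
Qed.

Lemma clamp_eq1 t : 1 <= t -> clamp t = 1.
Proof. by move=> t1; rewrite /clamp (min_idPl t1); exact/max_idPr. Qed.

Lemma clamp_lip s t : `|clamp s - clamp t| <= `|s - t|.
Proof.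
apply: le_trans (ler_dist_max _ _ _ _) _; rewrite subrr normr0 add0r.
by apply: le_trans (ler_dist_min _ _ _ _) _; rewrite subrr normr0 add0r.
Qed.

End clamp.

(** * Separability of locally compact geodesic spaces *)

Section separability.
Context {R : realType} {H : metricType R}.
Implicit Types (A D : set H) (x y : H).

Lemma closure_mdistP D x :
  closure D x <-> forall e : R, 0 < e -> exists2 y, D y & mdist x y < e.
Proof.
split=> [Dx e e0|Dx B /nbhs_ballP[e /= e0]].
  have [y [Dy]] := Dx _ (nbhsx_ballx x _ e0).
  by rewrite ballEmdist => xy; exists y.
by have [y Dy xy] := Dx e e0; rewrite ballEmdist => /(_ y xy) By; exists y.
Qed.

(** Near [x], any list that contains [x] works; compactness, as near-covering for the filter of
    growing finite lists, makes one list work for all of [A]. *)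
Lemma compact_finite_net A (e : R) : compact A -> 0 < e ->
  exists s : seq H, forall x, A x -> exists2 y, y \in s & mdist x y < e.
Proof.
move=> /compact_near_coveringP cA e0.
pose F : set_system (seq H) :=
  [set P | exists s0 : seq H, forall s : seq H, {subset s0 <= s} -> P s].
have FF : Filter F.
  split=> [|P Q [s sP] [t tQ]|P Q PQ [s sP]].
  - by exists [::].
  - exists (s ++ t) => u stu; split.
      by apply: sP => x xs; apply: stu; rewrite mem_cat xs.
    by apply: tQ => x xs; apply: stu; rewrite mem_cat xs orbT.
  - by exists s => t st; exact/PQ/sP.
have [|s sA] := cA _ F (fun s x => exists2 y, y \in s & mdist x y < e) FF.
  move=> x Ax; exists (ball x e, [set s : seq H | x \in s]) => /=.
    split; first exact: nbhsx_ballx.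
    by exists [:: x] => s; apply; rewrite mem_head.
  move=> [x' t] /= [+ xt]; rewrite ballEmdist /= => xx'.
  by exists x => //; rewrite metric_sym.
by exists s; exact: sA.
Qed.

(** The countable set need not lie in [A], so the property passes to subsets at once. *)
Definition in_separable A := exists2 D, countable D & A `<=` closure D.

Lemma compact_in_separable A : compact A -> in_separable A.
Proof.
move=> cA.
have /choice[s sP] : forall k, exists s : seq H,
    forall x, A x -> exists2 y, y \in s & mdist x y < k.+1%:R^-1.
  by move=> k; apply: compact_finite_net => //; rewrite invr_gt0.
exists (\bigcup_k [set` s k]).
  apply: bigcup_countable => // k _.
  exact/finite_set_countable/finite_seq.
move=> x Ax; apply/closure_mdistP => e e0.
have [k ke] : exists k, k.+1%:R^-1 < e.
  have [k _ kP] := near_infty_natSinv_lt (PosNum e0).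
  by exists k; exact: (kP k (leqnn k)).
have [y ys xy] := sP k x Ax; exists y; first by exists k.
exact: lt_trans ke.
Qed.

(** The preimage of [C] under a geodesic from [a] to [y], extended to the line, is clopen and
    contains 0, hence contains 1. *)
Lemma geodesic_space_connected (C : set H) (a : H) :
  geodesic_space H -> clopen C -> C a -> C = setT.
Proof.
move=> gH [oC cC] Ca; apply/seteqP; split=> // y _.
have [c [c0 c1 cd]] := gH a y.
have cc : continuous (c \o clamp).
  move=> t; apply/metricType_numDomainType.cvgrPdist_lt => e e0.
  have m0 : 0 < 1 + mdist a y by rewrite ltr_pwDl // mdist_ge0.
  have d0 : 0 < e / (1 + mdist a y) by rewrite divr_gt0.
  near=> s; rewrite /= cd ?clamp01//.
  have st : `|t - s| < e / (1 + mdist a y).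
    by near: s; exact: (@cvgr_dist_lt _ _ _ _ _ id t).
  have := clamp_lip t s; have := mdist_ge0 a y.
  move: st; rewrite ltr_pdivlMr // => *.
  apply: (@le_lt_trans _ _ (`|t - s| * mdist a y)); first exact: ler_wpM2r.
  by nra.
have cT : connected [set: R] by apply/connected_intervalP => ? ? _ _.
have /seteqP[_ /(_ 1 I)] : (c \o clamp) @^-1` C = setT.
  apply: cT.
  - by exists 0; rewrite /= clamp_eq0 // c0.
  - exists ((c \o clamp) @^-1` C); last by rewrite setTI.
    by apply: open_comp => // t _; exact: cc.
  - exists ((c \o clamp) @^-1` C); last by rewrite setTI.
    by apply: preimage_closed => // t _; exact: cc.
by rewrite /= clamp_eq1 // c1.
Unshelve. all: by end_near. Qed.

(* Starting from a point, repeatedly adjoin countable nets of all balls of radius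
   1 / k.+1 that have one, centered at the points already obtained. The closure
   of the resulting set is open. *)
Lemma locally_compact_geodesic_separable (a : H) :
  geodesic_space H -> locally_compact [set: H] ->
  exists2 D : set H, countable D & closure D = setT.
Proof.
move=> gH lH.
(* Pairs whose ball is not [in_separable] only ask for countability, so that one choice function [E]
   covers all pairs. *)
pose P (xk : H * nat) (D : set H) := countable D /\
  (in_separable (ball xk.1 xk.2.+1%:R^-1) ->
   ball xk.1 xk.2.+1%:R^-1 `<=` closure D).
have /choice[E EP] : forall xk, exists D, P xk D.
  move=> xk.
  have [[D cD sD]|nD] := pselect (in_separable (ball xk.1 xk.2.+1%:R^-1)).
    by exists D.
  by exists set0; split.
pose step D := D `|` \bigcup_(x in D) \bigcup_k E (x, k).
pose D := fix D k := if k is k'.+1 then step (D k') else [set a].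
have cD k : countable (D k).
  elim: k => [|k ih] /=; first exact: finite_set_countable.
  rewrite /step -bigcup2E; apply: bigcup_countable => // -[|[|i]] //= _.
  apply: bigcup_countable => // x _.
  by apply: bigcup_countable => // j _; exact: (EP (x, j)).1.
pose DD := \bigcup_k D k.
exists DD; first exact: bigcup_countable.
apply: (@geodesic_space_connected _ a) => //; last first.
  by apply: subset_closure; exists 0%N.
split; last exact: closed_closure.
rewrite openE => x DDx; rewrite /interior.
have [K xK [cK _]] := lH x I.
have /nbhs_ballP[e /= e0 eK] : nbhs x K.
  by apply: (filterS _ (xK : nbhs x (fun t => setT t -> K t))) => z; exact.
have [B cB KB] := compact_in_separable _ cK.
(* With radius 1 / k.+1 below [e / 2], the ball about a point [d] close to [x] contains [x] and
   stays in the compact [K]. *)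
have e20 : 0 < e / 2 by rewrite divr_gt0.
have [k _ /(_ k (leqnn k)) ke] := near_infty_natSinv_lt (PosNum e20).
have {}ke : k.+1%:R^-1 < e / 2 by [].
have k0 : 0 < k.+1%:R^-1 :> R by rewrite invr_gt0.
have /closure_mdistP/(_ _ k0)[d [j _ Djd] xd] := DDx.
have dE : ball d k.+1%:R^-1 `<=` closure (E (d, k)).
  apply: (EP (d, k)).2; exists B => //= z.
  rewrite ballEmdist /= => dz; apply/KB/eK; rewrite ballEmdist /=.
  rewrite (le_lt_trans (metric_triangle _ d _))// (splitr e).
  by rewrite ltrD // (lt_trans _ ke).
apply: (@filterS _ _ _ (ball d k.+1%:R^-1)).
  move=> z /dE; apply: closureS => t Et.
  by exists j.+1 => //; right; exists d => //; exists k.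
apply/nbhs_ballP; exists (k.+1%:R^-1 - mdist x d); rewrite /= ?subr_gt0 //.
move=> z; rewrite !ballEmdist /= ltrBrDl; apply: le_lt_trans.
by rewrite (metric_sym x d) metric_triangle.
Qed.

End separability.

(** * Lebesgue measurable sets of [R^n] *)

Section lebesgue.
Context {R : realType} {n : nat}.
Local Notation V := 'rV[R]_n.
Local Notation mu := (@lebesgue_measure_rV R n).

(** Together with [lower_part], this cuts a box along a hyperplane. When [c] is outside the i-th
    side, one of the parts is an empty box of volume 0. *)
Let upper_part i c (B : option (V * V)) :=
  if B is Some (a, b)
  then Some (\row_j (if j == i then Num.max (a 0 j) c else a 0 j), b) else None.

Let lower_part i c (B : option (V * V)) :=
  if B is Some (a, b)
  then Some (a, \row_j (if j == i then Num.min (b 0 j) c else b 0 j)) else None.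

Let box_upper_part i c B :
  box B `&` [set x | c < x 0 i] `<=` box (upper_part i c B).
Proof.
case: B => [[a b]|]; last by move=> ? [].
move=> x [/= xB cx] j; rewrite mxE; case: eqP => [->|_] //.
by rewrite gt_max cx andbT.
Qed.

Let box_lower_part i c B :
  box B `&` ~` [set x | c < x 0 i] `<=` box (lower_part i c B).
Proof.
case: B => [[a b]|]; last by move=> ? [].
move=> x [/= xB /negP]; rewrite -leNgt => cx j.
rewrite mxE; case: eqP => [->|_] //.
by rewrite le_min cx andbT.
Qed.

Let box_volume_split i c B :
  box_volume B = box_volume (upper_part i c B) + box_volume (lower_part i c B).
Proof.
case: B => [[a b]|]; last by rewrite /= addr0.
rewrite /= (bigD1 i) // [X in _ = X + _](bigD1 i) //.
rewrite [X in _ = _ + X](bigD1 i) //= !mxE !eqxx.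
under [X in _ = _ * X + _]eq_bigr => j /negbTE ji do rewrite mxE ji.
under [X in _ = _ + _ * X]eq_bigr => j /negbTE ji do rewrite mxE ji.
rewrite -mulrDl; congr (_ * _).
by case: (leP c (a 0 i)) => ?; case: (leP c (b 0 i)) => ?;
  do ! case: leP => ?; lra.
Qed.

Lemma box_volume_ge0 (B : option (V * V)) : 0 <= box_volume B.
Proof.
by case: B => [[a b]|] //=; apply: prodr_ge0 => i _; rewrite le_max lexx.
Qed.

Lemma lebesgue_outer_le (A : set V) B :
  box_cover A B -> (lebesgue_outer A <= \sum_(k <oo) (box_volume (B k))%:E)%E.
Proof. by move=> AB; apply: ereal_inf_lbound; exists B. Qed.

(** Cutting every box of a cover of [X] along the hyperplane gives covers of both parts of [X] with
    the same total volume, which is Caratheodory's criterion. *)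
Lemma halfspace_measurable i (c : R) :
  measurable ([set x | c < x 0 i] : set (lebesgue_space R n)).
Proof.
apply: (@le_caratheodory_measurable _ _ (@lebesgue_outer R n)) => X.
apply: le_ereal_inf_tmp => _ [B XB <-].
under eq_eseriesr do rewrite (box_volume_split i c) EFinD.
rewrite nneseriesD; last 2 first.
- by move=> k _ _; rewrite lee_fin box_volume_ge0.
- by move=> k _ _; rewrite lee_fin box_volume_ge0.
apply: leeD; apply: lebesgue_outer_le => x [Xx cx].
- by have [k _ kx] := XB x Xx; exists k => //; exact: box_upper_part.
- by have [k _ kx] := XB x Xx; exists k => //; exact: box_lower_part.
Qed.

Lemma box_bigsetI (a b : V) :
  box (Some (a, b)) = \big[setI/setT]_(i < n)
    ([set x | a 0 i < x 0 i] `&` ~` [set x | b 0 i < x 0 i]).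
Proof.
rewrite -bigcap_seq; apply/seteqP; split=> x /= xab i.
  by move=> _; have /andP[? ?] := xab i; split=> //=; apply/negP; rewrite -leNgt.
by have [/= -> /negP] := xab i (mem_index_enum i); rewrite -leNgt.
Qed.

Lemma box_measurable (B : option (V * V)) :
  measurable (box B : set (lebesgue_space R n)).
Proof.
case: B => [[a b]|]; last exact: measurable0.
rewrite box_bigsetI; elim/big_ind: _ => [|A B|i _]; first exact: measurableT.
  exact: measurableI.
by apply: measurableI; [|apply: measurableC]; exact: halfspace_measurable.
Qed.

(** An open set is the union of the boxes with rational corners that it contains, and there are
    countably many of them. *)
Lemma open_lebesgue_measurable (U : set V) :
  open U -> measurable (U : set (lebesgue_space R n)).
Proof.
move=> oU.
pose rbox (ab : 'rV[rat]_n * 'rV[rat]_n) : set V :=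
  box (Some (map_mx ratr ab.1, map_mx ratr ab.2)).
have -> : U = \bigcup_ab (if `[< rbox ab `<=` U >] then rbox ab else set0).
  apply/seteqP; split=> [x Ux|x [ab _]]; last first.
    by case: ifPn => // /asboolP; exact.
  have /nbhs_ballP[e /= e0 eU] : nbhs x U by exact: open_nbhs_nbhs.
  have [a aP] : exists a : 'I_n -> rat, forall i, x 0 i - e < ratr (a i) < x 0 i.
    suff /choice[a aP] : forall i, exists q : rat, x 0 i - e < ratr q < x 0 i.
      by exists a.
    move=> i; have [|q] := @rat_in_itvoo R (x 0 i - e) (x 0 i).
      by rewrite gtrBl.
    by rewrite in_itv; exists q.
  have [b bP] : exists b : 'I_n -> rat, forall i, x 0 i < ratr (b i) < x 0 i + e.
    suff /choice[b bP] : forall i, exists q : rat, x 0 i < ratr q < x 0 i + e.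
      by exists b.
    move=> i; have [|q] := @rat_in_itvoo R (x 0 i) (x 0 i + e).
      by rewrite ltrDl.
    by rewrite in_itv; exists q.
  exists (\row_i a i, \row_i b i) => //; rewrite asboolT.
    move=> i; rewrite !mxE; move: (aP i) (bP i) => /andP[_ ->] /andP[+ _].
    exact: ltW.
  move=> y yab; apply: eU; split=> // j i; rewrite (ord1 j).
  move: (yab i) (aP i) (bP i); rewrite !mxE => *.
  by rewrite /ball /= ltr_norml; lra.
apply: countable_bigcupT_measurable => // ab.
by case: ifPn => _; [exact: box_measurable|exact: measurable0].
Qed.

Lemma bounded_set_lebesgue_fin (A : set V) : bounded_set A ->
  (mu (A : set (lebesgue_space R n)) < +oo)%E.
Proof.
move=> [M [_ /(_ (M + 1))]]; rewrite ltrDl ltr01 => /(_ isT) AM.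
(* A box excludes its lower faces, so the lower corner is moved out by one more unit. *)
pose B := Some (const_mx (- (M + 2)), const_mx (M + 1)) : option (V * V).
apply: (@le_lt_trans _ _ (\sum_(k <oo)
    (box_volume (if k == 0%N then B else None))%:E)%E).
  apply: lebesgue_outer_le => x /AM /= xM; exists 0%N => // i; rewrite !mxE.
  have : `|x 0 i| <= M + 1.
    apply: le_trans xM; rewrite [leRHS]/Num.norm /= mx_normrE.
    by apply/bigmax_geP; right => /=; exists (0, i).
  by rewrite ler_norml; lra.
rewrite (nneseries_split _ 1); last first.
  by move=> k _; rewrite lee_fin box_volume_ge0.
rewrite eseries0 ?adde0; last by move=> [|k].
by rewrite big_nat1 ltry.
Qed.

End lebesgue.

(** * Lipschitz functions for the Euclidean distance *)

Section edist.
Context {R : realType} {n : nat}.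
Implicit Types (x y : 'rV[R]_n) (phi psi : 'rV[R]_n -> R).

Lemma edist_rV_ge0 x y : 0 <= edist x y.
Proof. exact: sqrtr_ge0. Qed.

Lemma ler_coord_edist i x y : `|x 0 i - y 0 i| <= edist x y.
Proof.
rewrite -sqrtr_sqr ler_wsqrtr // (bigD1 i) //= lerDl.
by apply: sumr_ge0 => j _; exact: sqr_ge0.
Qed.

Lemma edist_le_coord x y (d : R) : 0 <= d ->
  (forall i, `|x 0 i - y 0 i| <= d) -> edist x y <= n%:R * d.
Proof.
move=> d0 xyd; rewrite -(ger0_norm (mulr_ge0 (ler0n R n) d0)) -sqrtr_sqr.
apply: ler_wsqrtr; apply: (@le_trans _ _ (\sum_(i < n) d ^+ 2)).
  apply: ler_sum => i _.
  by rewrite -[leLHS]real_normK ?num_real // lerXn2r ?nnegrE ?xyd.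
rewrite sumr_const card_ord -[d ^+ 2 *+ n]mulr_natl exprMn.
apply: ler_wpM2r; first exact: sqr_ge0.
by rewrite -natrX ler_nat; case: (n) => // k; rewrite -mulnn leq_pmulr.
Qed.

Definition edist_lipschitz phi :=
  exists2 L : R, 0 <= L & forall x y, `|phi x - phi y| <= L * edist x y.

Lemma edist_lipschitz_cst (c : R) : edist_lipschitz (fun=> c).
Proof. by exists 0 => // x y; rewrite subrr normr0 mul0r. Qed.

Lemma edist_lipschitz_coord i : edist_lipschitz (fun x => x 0 i).
Proof. by exists 1 => // x y; rewrite mul1r ler_coord_edist. Qed.

Lemma edist_lipschitzD phi psi : edist_lipschitz phi -> edist_lipschitz psi ->
  edist_lipschitz (fun x => phi x + psi x).
Proof.
move=> [L L0 phiL] [M M0 psiM]; exists (L + M) => [|x y]; first exact: addr_ge0.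
rewrite opprD addrACA mulrDl.
exact: le_trans (ler_normD _ _) (lerD (phiL _ _) (psiM _ _)).
Qed.

Lemma edist_lipschitzM (c : R) phi : edist_lipschitz phi ->
  edist_lipschitz (fun x => c * phi x).
Proof.
move=> [L L0 phiL]; exists (`|c| * L) => [|x y]; first exact: mulr_ge0.
by rewrite -mulrBr normrM -mulrA ler_wpM2l.
Qed.

Lemma edist_lipschitz_min phi psi : edist_lipschitz phi -> edist_lipschitz psi ->
  edist_lipschitz (fun x => Num.min (phi x) (psi x)).
Proof.
move=> [L L0 phiL] [M M0 psiM]; exists (L + M) => [|x y]; first exact: addr_ge0.
rewrite mulrDl.
exact: le_trans (ler_dist_min _ _ _ _) (lerD (phiL _ _) (psiM _ _)).
Qed.

Lemma edist_lipschitz_clamp phi : edist_lipschitz phi ->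
  edist_lipschitz (fun x => clamp (phi x)).
Proof.
move=> [L L0 phiL]; exists L => // x y.
exact: le_trans (clamp_lip _ _) (phiL _ _).
Qed.

End edist.

(** * Lipschitz functions that agree with indicators off small sets *)

Lemma nonincreasing_measure_small d (T : measurableType d) (R : realType)
    (m : {measure set T -> \bar R}) (F : (set T)^nat) (e : R) :
  (m (F 0%N) < +oo)%E -> (forall k, measurable (F k)) ->
  (forall k, F k.+1 `<=` F k) -> \bigcap_k F k = set0 -> 0 < e ->
  exists k, (m (F k) < e%:E)%E.
Proof.
move=> F0 mF dF F_0 e0.
have dF' : {homo F : i j / (i <= j)%N >-> (j <= i)%O}.
  by apply/nonincreasing_seqP => k; apply/subsetPset; exact: dF.
have mF_0 : measurable (\bigcap_k F k) by rewrite F_0.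
have := @nonincreasing_cvg_mu _ _ _ m F F0 mF mF_0 dF'.
rewrite F_0 measure0 => mF0.
have : nbhs (0%E : \bar R) [set x | (x < e%:E)%E].
  exact: (@nbhs_open_ereal_lt _ 0 (fun=> e)).
by move=> /mF0[k _ /(_ k (leqnn k))] ?; exists k.
Qed.

Section lipschitz_indicator.
Context {R : realType} {n : nat}.
Local Notation V := (lebesgue_space R n).
Local Notation mu := (@lebesgue_measure_rV R n).
Variable Omega : set V.
Hypotheses (mOmega : measurable Omega) (Omega_fin : (mu Omega < +oo)%E).
Implicit Types (A B : set V).

(** Agreement off a small set, as in Lusin's theorem, rather than closeness of values: it survives
    composition with any curve in [H]. *)
Definition lipschitz_approximable A := forall e : R, 0 < e ->
  exists2 phi : 'rV[R]_n -> R, edist_lipschitz phi &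
  exists B, [/\ measurable B, (mu B < e%:E)%E &
    forall x, Omega x -> ~ B x -> phi x = \1_A x].

(** Half of [e] is spent on passing from [A] to [A'], the other half on approximating [A']. *)
Lemma lipschitz_approximable_lim A :
  (forall e : R, 0 < e -> exists2 A', lipschitz_approximable A' &
    exists B, [/\ measurable B, (mu B < e%:E)%E &
      forall x, Omega x -> ~ B x -> A x <-> A' x]) ->
  lipschitz_approximable A.
Proof.
move=> H e e0; have e20 : 0 < e / 2 by rewrite divr_gt0.
have [A' aA' [B [mB Be AA']]] := H _ e20.
have [phi lphi [C [mC Ce phiA']]] := aA' _ e20.
exists phi => //; exists (B `|` C); split.
- exact: measurableU.
- apply: le_lt_trans (measureU2 _ mB mC) _.
  by rewrite (splitr e) EFinD; exact: lteD.
- move=> x Ox BCx; rewrite phiA' //; last by move=> Cx; apply: BCx; right.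
  have Bx : ~ B x by move=> Bx; apply: BCx; left.
  by rewrite !indicE; congr (nat_of_bool _)%:R; apply/idP/idP;
    rewrite !inE => /(AA' x Ox Bx).
Qed.

Lemma lipschitz_approximableC A :
  lipschitz_approximable A -> lipschitz_approximable (~` A).
Proof.
move=> aA e e0; have [phi lphi [B [mB Be phiA]]] := aA e e0.
exists (fun x => 1 + -1 * phi x).
  by apply: edist_lipschitzD; [exact: edist_lipschitz_cst|exact: edist_lipschitzM].
exists B; split=> // x Ox Bx; rewrite phiA // !indicE in_setC.
by case: (x \in A); rewrite /= ?mulr1 ?mulr0 ?subrr ?addr0.
Qed.

(** Off both exceptional sets, the minimum of the two functions is the product of the two
    indicators. *)
Lemma lipschitz_approximableI A A' : lipschitz_approximable A ->
  lipschitz_approximable A' -> lipschitz_approximable (A `&` A').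
Proof.
move=> aA aA' e e0; have e20 : 0 < e / 2 by rewrite divr_gt0.
have [phi lphi [B [mB Be phiA]]] := aA _ e20.
have [psi lpsi [C [mC Ce psiA']]] := aA' _ e20.
exists (fun x => Num.min (phi x) (psi x)); first exact: edist_lipschitz_min.
exists (B `|` C); split.
- exact: measurableU.
- apply: le_lt_trans (measureU2 _ mB mC) _.
  by rewrite (splitr e) EFinD; exact: lteD.
- move=> x Ox BCx; rewrite phiA ?psiA' //; [|by move=> ?; apply: BCx; right..|].
    rewrite !indicE in_setI; case: (x \in A); case: (x \in A') => //=;
      by rewrite ?minxx // minElt ?ltr10 ?ltr01.
  by move=> ?; apply: BCx; left.
Qed.

Lemma lipschitz_approximableT : lipschitz_approximable setT.
Proof.
move=> e e0; exists (fun=> 1); first exact: edist_lipschitz_cst.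
by exists set0; split => // [|x _ _]; rewrite ?measure0 ?lte_fin // indicT.
Qed.

(** A ramp rises from 0 to 1 across a slab of width 1 / k.+1 next to the hyperplane. In [Omega] it
    can differ from the indicator only in the slab, and the slabs decrease to the empty set. *)
Lemma halfspace_lipschitz_approximable i (c : R) :
  lipschitz_approximable [set x : 'rV[R]_n | c < x 0 i].
Proof.
move=> e e0.
pose F k : set V := Omega `&` ([set x : 'rV[R]_n | c < x 0 i] `&`
  ~` [set x : 'rV[R]_n | c + k.+1%:R^-1 < x 0 i]).
have mF k : measurable (F k).
  apply: measurableI => //; apply: measurableI; first exact: halfspace_measurable.
  exact/measurableC/halfspace_measurable.
have [k Fke] : exists k, (mu (F k) < e%:E)%E.
  apply: nonincreasing_measure_small => //.
  - apply: le_lt_trans Omega_fin; apply: le_measure; rewrite ?inE //.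
    exact: subIsetl.
  - move=> k x [Ox [cx /negP]]; rewrite -leNgt => xk; split=> //; split=> //.
    apply/negP; rewrite -leNgt (le_trans xk) // lerD2l lef_pV2 ?posrE //.
    by rewrite ler_nat.
  - rewrite -subset0 => x Fx; have [_ [/= cx _]] := Fx 0%N I.
    have xc0 : 0 < x 0 i - c by rewrite subr_gt0.
    have [k _ /(_ k (leqnn k)) /= kxc] := near_infty_natSinv_lt (PosNum xc0).
    by have [_ [_]] := Fx k I; apply => /=; rewrite -ltrBrDl.
exists (fun x => clamp (k.+1%:R * (x 0 i + - c))).
  apply: edist_lipschitz_clamp; apply: edist_lipschitzM.
  by apply: edist_lipschitzD; [exact: edist_lipschitz_coord|exact: edist_lipschitz_cst].
exists (F k); split => // x Ox Fx; rewrite indicE.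
have [cx|xc] := ltP c (x 0 i).
  rewrite mem_set //; apply: clamp_eq1.
  rewrite -ler_pdivrMl // mulr1 lerBrDl leNgt; apply/negP => xk; apply: Fx.
  by split=> //; split=> //=; apply/negP; rewrite -leNgt ltW.
rewrite memNset /=; last by apply/negP; rewrite -leNgt.
by apply: clamp_eq0; rewrite pmulr_rle0 // subr_le0.
Qed.

Lemma box_lipschitz_approximable (B : option ('rV[R]_n * 'rV[R]_n)) :
  lipschitz_approximable (box B).
Proof.
case: B => [[a b]|]; last first.
  have -> : box None = ~` [set: V] by rewrite setCT.
  exact/lipschitz_approximableC/lipschitz_approximableT.
rewrite box_bigsetI; elim/big_ind: _ => [|A B|i _].
- exact: lipschitz_approximableT.
- exact: lipschitz_approximableI.
- apply: lipschitz_approximableI; [|apply: lipschitz_approximableC];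
    exact: halfspace_lipschitz_approximable.
Qed.

(** Finite unions come from intersections and complements; the points of the union missed by the
    first [k] sets decrease to the empty set. *)
Lemma lipschitz_approximable_bigcup (A : (set V)^nat) :
  (forall k, measurable (A k)) -> (forall k, lipschitz_approximable (A k)) ->
  lipschitz_approximable (\bigcup_k A k).
Proof.
move=> mA aA; apply: lipschitz_approximable_lim => e e0.
pose C k := \big[setI/setT]_(j < k) ~` A j.
have mC k : measurable (C k).
  rewrite /C; elim/big_ind: _ => [|? ?|j _]; first exact: measurableT.
    exact: measurableI.
  exact: measurableC.
pose F k : set V := Omega `&` (\bigcup_k A k `&` C k).
have mF k : measurable (F k).
  by apply: measurableI => //; apply: measurableI => //; exact: bigcupT_measurable.
have [k Fke] : exists k, (mu (F k) < e%:E)%E.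
  apply: nonincreasing_measure_small => //.
  - apply: le_lt_trans Omega_fin; apply: le_measure; rewrite ?inE //.
    exact: subIsetl.
  - move=> k x [Ox [Ax Cx]]; split=> //; split=> //.
    by move: Cx; rewrite /C big_ord_recr => -[].
  - rewrite -subset0 => x Fx; have [_ [[k _ Akx] _]] := Fx 0%N I.
    by have [_ [_]] := Fx k.+1 I; rewrite /C big_ord_recr => -[_]; exact.
exists (~` C k).
  apply: lipschitz_approximableC; rewrite /C; elim/big_ind: _ => [|? ?|j _].
  - exact: lipschitz_approximableT.
  - exact: lipschitz_approximableI.
  - exact: lipschitz_approximableC.
exists (F k); split=> // x Ox Fx; split=> [Ax Cx|]; first exact: Fx.
rewrite /C -(bigcap_mkord k (fun j => ~` A j)) setC_bigcap => -[j _ /= nA].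
exists j => //.
exact: contrapT.
Qed.

(** The outer measure is an infimum over box covers, so [A] lies in a union of boxes that exceeds it
    by a set of measure less than [e]. *)
Lemma measurable_lipschitz_approximable A : measurable A -> A `<=` Omega ->
  lipschitz_approximable A.
Proof.
move=> mA AO; apply: lipschitz_approximable_lim => e e0.
have Afin : mu A \is a fin_num.
  rewrite ge0_fin_numE //; apply: le_lt_trans Omega_fin.
  by apply: le_measure; rewrite ?inE.
have [_ [B AB <-] Be] := lb_ereal_inf_adherent e0 Afin.
have mB k : measurable (box (B k) : set V) by exact: box_measurable.
pose U : set V := \bigcup_k box (B k).
have mU : measurable U by exact: bigcupT_measurable.
exists U.
  by apply: lipschitz_approximable_bigcup => // k; exact: box_lipschitz_approximable.
exists (U `\` A); split; first exact: measurableD.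
- have Ue : (mu U < mu A + e%:E)%E.
    by apply: le_lt_trans Be; exact: lebesgue_outer_le.
  rewrite measureD // ?setIidr //; last first.
    by rewrite (lt_le_trans Ue) // leey.
  by rewrite lteBlDl.
- move=> x _ UAx; split=> [/AB //|Ux].
  by apply: contrapT => nAx; exact: UAx.
Qed.

End lipschitz_indicator.

(* Concatenated geodesics: composition with [gamma] turns the approximation of
   maps with finitely many values in [H] into one of real functions. *)
Lemma geodesic_curve (R : realType) (H : metricType R) (d : nat -> H) (N : nat) :
  geodesic_space H ->
  exists gamma : R -> H, exists L M : R,
    [/\ forall s t, mdist (gamma s) (gamma t) <= L * `|s - t|,
        forall t, mdist (d 0%N) (gamma t) <= M
      & forall i, (i <= N)%N -> gamma i%:R = d i].
Proof.
move=> gH.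
suff [gamma [L [M [g1 g2 g3 g4]]]] : exists gamma : R -> H, exists L M : R,
    [/\ forall s t, mdist (gamma s) (gamma t) <= L * `|s - t|,
        forall t, mdist (d 0%N) (gamma t) <= M,
        forall i, (i <= N)%N -> gamma i%:R = d i
      & forall t, N%:R <= t -> gamma t = d N] by exists gamma, L, M.
elim: N => [|N [g [L [M [gL gM gd gN]]]]].
  exists (fun=> d 0%N), 0, 0; split => //.
  - by move=> s t; rewrite mdistxx mul0r.
  - by move=> t; rewrite mdistxx.
  - by case.
have [c [c0 c1 cd]] := gH (d N) (d N.+1).
have c01 u v : mdist (c (clamp u)) (c (clamp v)) <= mdist (d N) (d N.+1) * `|u - v|.
  rewrite cd ?clamp01 // mulrC; apply: ler_wpM2l; first exact: mdist_ge0.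
  exact: clamp_lip.
(* The new geodesic occupies [[N, N + 1]]; the truncation keeps the curve at [d N.+1] afterwards. *)
pose g' t := if t <= N%:R then g t else c (clamp (t - N%:R)).
pose L' := Num.max L (mdist (d N) (d N.+1)).
have g'N t : N%:R <= t -> g' t = c (clamp (t - N%:R)).
  rewrite /g' le_eqVlt => /orP[/eqP <-|/lt_geF -> //].
  by rewrite lexx subrr clamp_eq0 // c0 gN.
have g'L s t : s <= t -> mdist (g' s) (g' t) <= L' * `|s - t|.
  move=> st; have LL' : L <= L' by rewrite le_max lexx.
  have ML' : mdist (d N) (d N.+1) <= L' by rewrite le_max lexx orbT.
  have [tN|Nt] := leP t N%:R.
    rewrite /g' tN (le_trans st tN); apply: le_trans (gL _ _) _.
    exact: ler_wpM2r.
  rewrite (g'N t (ltW Nt)).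
  have [sN|Ns] := leP s N%:R; last first.
    rewrite (g'N s (ltW Ns)) (le_trans (c01 _ _))//.
    have -> : s - N%:R - (t - N%:R) = s - t by ring.
    exact: ler_wpM2r.
  (* With [s] and [t] on different sides of the junction, the estimate goes through [d N], the value
     at the parameter [N]. *)
  rewrite /g' sN; apply: le_trans (metric_triangle _ (d N) _) _.
  have -> : mdist (g s) (d N) = mdist (g s) (g N%:R) by rewrite (gN _ (lexx _)).
  have -> : mdist (d N) (c (clamp (t - N%:R))) =
      mdist (c (clamp 0)) (c (clamp (t - N%:R))) by rewrite (clamp_eq0 0) // c0.
  apply: le_trans (lerD (gL _ _) (c01 _ _)) _.
  rewrite sub0r normrN (ger0_norm (_ : 0 <= t - N%:R)) ?subr_ge0 ?(ltW Nt) //.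
  rewrite distrC [`|s - t|]distrC !ger0_norm ?subr_ge0 //.
  have := ltW Nt; rewrite -subr_ge0 => tN0.
  have := sN; rewrite -subr_ge0 => sN0.
  have := ler_wpM2r tN0 ML'; have := ler_wpM2r sN0 LL'; nra.
exists g', L', (M + mdist (d N) (d N.+1)); split.
- move=> s t; have [st|/ltW ts] := leP s t; first exact: g'L.
  by rewrite metric_sym distrC g'L.
- move=> t; rewrite /g'; case: ifPn => _.
    by rewrite ler_wpDr ?gM // mdist_ge0.
  apply: le_trans (metric_triangle _ (d N) _) _; apply: lerD.
    by rewrite -(gN _ (lexx _)) gM.
  rewrite -[X in mdist X (c _)]c0 cd ?lexx ?ler01 ?clamp01 //.
  apply: ler_piMl; first exact: mdist_ge0.
  by rewrite sub0r normrN ger0_norm; case/andP: (clamp01 (t - N%:R)).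
- move=> i; rewrite leq_eqVlt => /orP[/eqP ->|].
    by rewrite g'N ?ler_nat // -natr1 addrAC subrr add0r clamp_eq1.
  by rewrite ltnS => iN; rewrite /g' ler_nat iN gd.
- move=> t Nt; rewrite g'N; last by rewrite (le_trans _ Nt) // ler_nat.
  by rewrite clamp_eq1 // lerBrDr addrC natr1.
Qed.

(** * Measurability and boundedness of uniformly continuous maps *)

Section unif_continuous.
Context {R : realType} {n : nat} {H : completeMetricType R}.
Variable Omega : set 'rV[R]_n.

(** The balls are those of the sup norm, which [edist] exceeds at most by a factor [n]; [n.+1] makes
    the inequality strict and the divisor nonzero. *)
Lemma edist_lt_ball (x y : 'rV[R]_n) (d : R) :
  0 < d -> ball x (d / n.+1%:R) y -> edist x y < d.
Proof.
move=> d0 [_ xy]; have dn0 : 0 < d / n.+1%:R by rewrite divr_gt0.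
apply: (@le_lt_trans _ _ (n%:R * (d / n.+1%:R))).
  by apply: edist_le_coord => [|i]; [exact: ltW|have /ltW := xy 0 i].
by rewrite mulrCA gtr_pMr // ltr_pdivrMr // mul1r ltr_nat.
Qed.

(** Open sets have open preimages in the open set [Omega], and they generate the Borel
    sigma-algebra. *)
Lemma unif_continuous_borel (g : 'rV[R]_n -> H) :
  open Omega -> unif_continuous_on Omega g -> borel_measurable Omega g.
Proof.
move=> oO ug; rewrite /borel_measurable.
apply: measurability; first exact: erefl.
move=> _ [V oV <-].
apply: open_lebesgue_measurable; rewrite openE => x [Ox /= Vgx].
have /nbhs_ballP[e /= e0 eV] : nbhs (g x) V by exact: open_nbhs_nbhs.
have [d d0 dP] := ug e e0.
have : nbhs x Omega by exact: open_nbhs_nbhs.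
have xd : nbhs x (ball x (d / n.+1%:R)) by apply: nbhsx_ballx; rewrite divr_gt0.
apply: filterS2 xd => y xy Oy; split=> //=.
by apply: eV; rewrite ballEmdist; apply: dP => //; exact: edist_lt_ball.
Qed.

(** Each point of the compact closure has a neighbourhood in which [g] stays within 1 of one of its
    values; near-covering along [M] tending to infinity then gives a common bound. *)
Lemma unif_continuous_bounded (g : 'rV[R]_n -> H) (a : H) :
  bounded_set Omega -> unif_continuous_on Omega g ->
  exists M : R, forall x, Omega x -> mdist (g x) a <= M.
Proof.
move=> bO ug; have [d d0 dP] := ug 1 ltr01.
have cO : compact (closure Omega).
  apply: bounded_closed_compact; last exact: closed_closure.
  have [M [Mreal OM]] := bO; exists M; split=> // N /OM ON.
  have cM : closed [set x : 'rV[R]_n | `|x| <= N].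
    by apply: preimage_closed (@closed_le _ N) => x _; exact: norm_continuous.
  by move=> x Ox; apply: cM; exact: closureS Ox.
have /compact_near_coveringP := cO.
move=> /(_ R +oo (fun M x => Omega x -> mdist (g x) a <= M) _)[|M [_ /(_ (M + 1))]].
  move=> x Ox.
  (* Half of the radius, since points of [Omega] are compared with [y] through [x], which may lie on
     the boundary. *)
  have r0 : 0 < d / n.+1%:R / 2 by rewrite !divr_gt0.
  have [y [Oy xy]] := Ox _ (nbhsx_ballx x _ r0).
  exists (ball x (d / n.+1%:R / 2), [set M | 1 + mdist (g y) a <= M]) => /=.
    by split; [exact: nbhsx_ballx|exact: (nbhs_pinfty_ge (num_real _))].
  move=> [x' M] /= [xx' yM] Ox'; apply: le_trans yM.
  apply: le_trans (metric_triangle _ (g y) _) _.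
  rewrite lerD2r ltW // dP // edist_lt_ball // (splitr (d / _)).
  exact: ball_triangle (ball_sym xx') xy.
rewrite ltrDl ltr01 => /(_ isT) MP.
by exists (M + 1) => x Ox; apply: MP => //; exact: subset_closure.
Qed.

End unif_continuous.

(** * Dense sequences and measurability of the distance between two maps *)

Lemma separable_dense_sequence (R : realType) (H : metricType R) (D : set H) (a : H) :
  countable D -> closure D = setT ->
  exists d : nat -> H, forall x (e : R), 0 < e -> exists i, mdist x (d i) < e.
Proof.
move=> /pfcard_geP[->|/unsquash d] DT.
  by have := I : [set: H] a; rewrite -DT closure0.
exists d => x e e0; have : closure D x by rewrite DT.
move=> /closure_mdistP/(_ _ e0)[y /(@surj _ _ _ _ d)[i _ <-] xy].
by exists i.
Qed.

(** The sum is at most twice the larger term, whose power is one of the two summands. *)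
Lemma powRD_le (R : realType) (p a b : R) : 0 <= p -> 0 <= a -> 0 <= b ->
  (a + b) `^ p <= 2 `^ p * (a `^ p + b `^ p).
Proof.
move=> p0 a0 b0.
wlog ba : a b a0 b0 / b <= a => [hw|].
  have [/hw|/ltW/hw] := leP b a; first exact.
  by rewrite addrC [b `^ _ + _]addrC; exact.
apply: (@le_trans _ _ ((2 * a) `^ p)).
  by apply: ge0_ler_powR; rewrite ?nnegrE ?addr_ge0 ?mulr_ge0 //; lra.
by rewrite powRM // ler_wpM2l ?powR_ge0 // lerDl powR_ge0.
Qed.

Section mdist_measurable.
Context d (T : measurableType d) {R : realType} {H : completeMetricType R}.
Variables (D : set T) (s : nat -> H).
Hypotheses (mD : measurable D)
  (s_dense : forall x (e : R), 0 < e -> exists i, mdist x (s i) < e).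
Implicit Types f g : T -> g_sigma_algebraType (@open H).

Lemma measurable_mdist_cst f (a : H) : measurable_fun D f ->
  measurable_fun D (fun x => mdist (f x : H) a).
Proof.
move=> mf _; apply: (measurability _ (RGenInftyO.measurableE R)) => //.
move=> _ [_ [r ->] <-].
have -> : (fun x => mdist (f x : H) a) @^-1` `]-oo, r[ = f @^-1` ball a r.
  by apply/seteqP; split=> x /=; rewrite in_itv /= ballEmdist /= metric_sym.
apply: mf => //; apply: sub_sigma_algebra.
rewrite openE => y; rewrite ballEmdist /= => ay.
apply/nbhs_ballP; exists (r - mdist a y); rewrite /= ?subr_gt0 //.
move=> z; rewrite !ballEmdist /= ltrBrDl; apply: le_lt_trans.
exact: metric_triangle.
Qed.

(** The set where the distance is below [r] is a countable union over the points [s i] of sets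
    described by distances to [s i]. Separability thus replaces a product sigma-algebra. *)
Lemma measurable_mdist f g : measurable_fun D f -> measurable_fun D g ->
  measurable_fun D (fun x => mdist (f x : H) (g x : H)).
Proof.
move=> mf mg _; apply: (measurability _ (RGenInftyO.measurableE R)) => //.
move=> _ [_ [r ->] <-].
pose h i x := mdist (f x : H) (s i) + mdist (g x : H) (s i).
have -> : D `&` (fun x => mdist (f x : H) (g x : H)) @^-1` `]-oo, r[ =
    \bigcup_i (D `&` h i @^-1` `]-oo, r[).
  apply/seteqP; split=> x /=; rewrite in_itv /=.
    (* The detour through [s i] costs twice the distance from [f x] to [s i], hence half of the
       gap. *)
    move=> [Dx xr]; have e0 : 0 < (r - mdist (f x : H) (g x : H)) / 2.
      by rewrite divr_gt0 // subr_gt0.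
    have [i fi] := s_dense (f x) _ e0; exists i => //; split=> //=.
    rewrite in_itv /= /h; have := metric_triangle (g x : H) (f x : H) (s i).
    by rewrite (metric_sym (g x : H) (f x)); lra.
  move=> [i _ [Dx /=]]; rewrite in_itv /= => hr; split=> //.
  apply: le_lt_trans hr; rewrite /h (metric_sym (g x : H) (s i)).
  exact: metric_triangle.
apply: bigcupT_measurable => i.
suff mh : measurable_fun D (h i) by apply: mh => //; exact: measurable_itv.
by apply: measurable_funD; exact: measurable_mdist_cst.
Qed.

End mdist_measurable.

(** * Integral estimates *)

Lemma ge0_integral_abs_continuous d (T : measurableType d) (R : realType)
    (m : {measure set T -> \bar R}) (D : set T) (h : T -> R) (e : R) :
  measurable D -> m.-integrable D (EFin \o h) -> (forall x, 0 <= h x) -> 0 < e ->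
  exists2 r : R, 0 < r & forall A, measurable A -> A `<=` D -> (m A < r%:E)%E ->
    (\int[m]_(x in A) (h x)%:E < e%:E)%E.
Proof.
move=> mD ih h0 e0.
have ih' : m.-integrable setT (EFin \o (h \_ D)).
  by rewrite -restrict_EFin; exact: (integrable_mkcond (EFin \o h) mD).1.
have [r [r0 rP]] := integral_normr_continuous ih' e0.
exists r => // A mA AD /(rP _ mA).
rewrite -lte_fin fineK.
  congr (_ < _)%E; apply: eq_integral => x xA.
  by rewrite patchE ifT ?ger0_norm // inE; apply: AD; rewrite -inE.
have ihA : m.-integrable A (EFin \o (h \_ D)) by exact: integrableS ih'.
exact/integrable_fin_num/(integrable_abse ihA).
Qed.

(** On [D], [u] lies below the sum of [c] and the extensions by 0 of [h] from [B] and of [k] from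
    [L], so the regions may overlap. *)
Lemma ge0_integral_le_pieces d (T : measurableType d) (R : realType)
    (m : {measure set T -> \bar R}) (D B L : set T) (u h k : T -> R) (c : R) :
  measurable D -> measurable B -> measurable L -> B `<=` D -> L `<=` D ->
  measurable_fun D u -> measurable_fun D h -> measurable_fun D k ->
  0 <= c -> (forall x, 0 <= u x) -> (forall x, 0 <= h x) -> (forall x, 0 <= k x) ->
  (forall x, D x -> [\/ u x <= c, B x /\ u x <= h x | L x /\ u x <= k x]) ->
  (\int[m]_(x in D) (u x)%:E <=
   c%:E * m D + \int[m]_(x in B) (h x)%:E + \int[m]_(x in L) (k x)%:E)%E.
Proof.
move=> mD mB mL BD LD mu_ mh mk c0 u0 h0 k0 ule.
have restrE (A : set T) (w : T -> R) : A `<=` D ->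
    (\int[m]_(x in A) (w x)%:E = \int[m]_(x in D) ((w \_ A) x)%:E)%E.
  move=> AD; rewrite -[in LHS](setIidr AD) integral_mkcondr.
  by apply: eq_integral => x _; rewrite !patchE; case: ifP.
have restr0 (A : set T) (w : T -> R) x : (forall x, 0 <= w x) -> 0 <= (w \_ A) x.
  by move=> w0; rewrite patchE; case: ifP.
have restrm (A : set T) (w : T -> R) : measurable A -> measurable_fun D w ->
    measurable_fun D (w \_ A).
  move=> mA mw; apply/measurable_restrict => //.
  by apply: measurable_funS mw => //; exact: subIsetl.
rewrite (restrE B) // (restrE L) // -integral_cst //.
rewrite -ge0_integralD //; last 2 first.
- by move=> x _; rewrite lee_fin restr0.
- exact/measurable_EFinP/restrm.
rewrite -ge0_integralD //; last 4 first.
- by move=> x _; rewrite -EFinD lee_fin addr_ge0 // restr0.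
- apply/measurable_EFinP; apply: measurable_funD => //; exact: restrm.
- by move=> x _; rewrite lee_fin restr0.
- exact/measurable_EFinP/restrm.
apply: ge0_le_integral => //.
- by move=> x _; rewrite lee_fin.
- exact/measurable_EFinP.
- apply/measurable_EFinP; apply: measurable_funD; last exact: restrm.
  by apply: measurable_funD => //; exact: restrm.
- move=> x Dx; rewrite -!EFinD lee_fin.
  have hB := restr0 B h x h0; have kL := restr0 L k x k0.
  case: (ule x Dx) => [ux|[Bx ux]|[Lx ux]].
  + by rewrite -addrA ler_wpDr // addr_ge0.
  + have -> : (h \_ B) x = h x by rewrite patchE mem_set.
    by apply: ler_wpDr => //; apply: ler_wpDl.
  + have -> : (k \_ L) x = k x by rewrite patchE mem_set.
    by apply: ler_wpDl => //; exact: addr_ge0.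
Qed.

Lemma ge0_integral_le_combination d (T : measurableType d) (R : realType)
    (m : {measure set T -> \bar R}) (D : set T) (u v w : T -> R) (K : R) :
  measurable D -> measurable_fun D u -> measurable_fun D v ->
  measurable_fun D w -> 0 <= K ->
  (forall x, 0 <= u x) -> (forall x, 0 <= v x) -> (forall x, 0 <= w x) ->
  (forall x, D x -> w x <= K * (u x + v x)) ->
  (\int[m]_(x in D) (w x)%:E <=
   K%:E * (\int[m]_(x in D) (u x)%:E + \int[m]_(x in D) (v x)%:E))%E.
Proof.
move=> mD mu_ mv mw K0 u0 v0 w0 wuv.
rewrite -ge0_integralD //; last 4 first.
- by move=> x _; rewrite lee_fin.
- exact/measurable_EFinP.
- by move=> x _; rewrite lee_fin.
- exact/measurable_EFinP.
rewrite -ge0_integralZl //; last 2 first.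
- by apply/measurable_EFinP; exact: measurable_funD.
- by move=> x _; rewrite -EFinD lee_fin addr_ge0.
apply: ge0_le_integral => //.
- by move=> x _; rewrite lee_fin.
- exact/measurable_EFinP.
- by apply/measurable_EFinP; apply: measurable_funM => //; exact: measurable_funD.
Qed.

Lemma measurable_fun_affine d (T : measurableType d) (R : realType) (D : set T)
    (h : T -> R) (K c : R) :
  measurable_fun D h -> measurable_fun D (fun x => K * (h x + c)).
Proof. by move=> mh; apply: measurable_funM => //; exact: measurable_funD. Qed.

(** * Density for the p-th power of the distance *)

Section energy.
Context {R : realType} {n : nat} {H : completeMetricType R}.
Local Notation V := (lebesgue_space R n).
Local Notation mu := (@lebesgue_measure_rV R n).
Variables (p : R) (Omega : set 'rV[R]_n) (s : nat -> H).
Hypotheses (p_gt0 : 0 < p) (oO : open Omega) (bO : bounded_set Omega).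
Hypothesis s_dense : forall x (e : R), 0 < e -> exists i, mdist x (s i) < e.
Implicit Types f g h : 'rV[R]_n -> H.

Let mO : measurable (Omega : set V).
Proof. exact: open_lebesgue_measurable. Qed.

Let Ofin : (mu Omega < +oo)%E.
Proof. exact: bounded_set_lebesgue_fin. Qed.

(** The p-th power of [dp]: it is additive over regions, and the root is taken only at the very
    end. *)
Definition energy f g : \bar R :=
  (\int[mu]_(x in Omega) (mdist (f x) (g x) `^ p)%:E)%E.

Lemma energy_ge0 f g : (0 <= energy f g)%E.
Proof. by apply: integral_ge0 => x _; rewrite lee_fin powR_ge0. Qed.

Lemma energy_sym f g : energy f g = energy g f.
Proof. by apply: eq_integral => x _; rewrite metric_sym. Qed.

Lemma measurable_mdist_powR f g :
  borel_measurable Omega f -> borel_measurable Omega g ->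
  measurable_fun (Omega : set V) (fun x => mdist (f x) (g x) `^ p).
Proof.
move=> mf mg; apply: (measurableT_comp (measurable_powR p)).
exact: (measurable_mdist _ _ _ s mO s_dense f g mf mg).
Qed.

(** Integrates [powRD_le]; it takes the place of Minkowski's inequality at the cost of a constant
    factor. *)
Lemma energy_triangle f g h :
  borel_measurable Omega f -> borel_measurable Omega g ->
  borel_measurable Omega h ->
  (energy f h <= (2 `^ p)%:E * (energy f g + energy g h))%E.
Proof.
move=> mf mg mh.
have mfg := measurable_mdist_powR f g mf mg.
have mgh := measurable_mdist_powR g h mg mh.
have mfh := measurable_mdist_powR f h mf mh.
apply: (ge0_integral_le_combination _ _ _ _ _ _ _ _ _ mO mfg mgh mfh);
  rewrite ?powR_ge0 //.
- by move=> x; exact: powR_ge0.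
- by move=> x; exact: powR_ge0.
- by move=> x; exact: powR_ge0.
- move=> x _.
  apply: le_trans (powRD_le _ _ _ _ (ltW p_gt0) (mdist_ge0 _ _) (mdist_ge0 _ _)).
  apply: ge0_ler_powR; rewrite ?nnegrE ?addr_ge0 ?mdist_ge0 ?(ltW p_gt0) //.
  exact: metric_triangle.
Qed.

(** Induction on the number of terms: half of [e] goes to the last term, half to the others. *)
Lemma lipschitz_approx_sum (A : (set V)^nat) (N : nat) (e : R) :
  (forall i, measurable (A i)) -> (forall i, A i `<=` Omega) -> 0 < e ->
  exists2 phi : 'rV[R]_n -> R, edist_lipschitz phi &
  exists B : set V, [/\ measurable B, (mu B < e%:E)%E &
    forall x, Omega x -> ~ B x -> phi x = \sum_(i < N) i%:R * \1_(A i) x].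
Proof.
move=> mA AO; elim: N e => [|N ih] e e0.
  exists (fun=> 0); first exact: edist_lipschitz_cst.
  by exists set0; split=> // [|x _ _]; rewrite ?measure0 ?lte_fin // big_ord0.
have e20 : 0 < e / 2 by rewrite divr_gt0.
have [phi lphi [B [mB Be phiB]]] := ih _ e20.
have [psi lpsi [C [mC Ce psiC]]] :=
  measurable_lipschitz_approximable Omega mO Ofin _ (mA N) (AO N) _ e20.
exists (fun x => phi x + N%:R * psi x).
  by apply: edist_lipschitzD => //; exact: edist_lipschitzM.
exists (B `|` C); split.
- exact: measurableU.
- apply: le_lt_trans (measureU2 _ mB mC) _.
  by rewrite (splitr e) EFinD; exact: lteD.
- move=> x Ox BCx; rewrite big_ord_recr /= phiB ?psiC //.
    by move=> ?; apply: BCx; right.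
  by move=> ?; apply: BCx; left.
Qed.

Lemma unif_continuous_lipschitz_comp (gamma : R -> H) (L : R)
    (phi : 'rV[R]_n -> R) :
  (forall a b, mdist (gamma a) (gamma b) <= L * `|a - b|) ->
  edist_lipschitz phi -> unif_continuous_on Omega (gamma \o phi).
Proof.
move=> gL [M M0 phiM] e e0.
have L0 : 0 <= L.
  have := gL 0 1; rewrite sub0r normrN normr1 mulr1.
  exact: le_trans (mdist_ge0 _ _).
(* The summand 1 keeps the divisor positive when a Lipschitz constant vanishes. *)
have LM0 : 0 < L * M + 1 by rewrite ltr_wpDl // mulr_ge0.
exists (e / (L * M + 1)) => [|x y _ _]; first by rewrite divr_gt0.
rewrite ltr_pdivlMr // => xy; apply: le_lt_trans (gL _ _) _.
have := ler_wpM2l L0 (phiM x y); have := edist_rV_ge0 x y; nra.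
Qed.

(** Three regions contribute at most [e / 3] each: where the two maps are within [eps], where [f]
    avoids the first [N] balls, and where [phi] may be wrong. *)
Lemma energy_dense f (e : R) (gH : geodesic_space H) :
  borel_measurable Omega f -> (energy f (fun=> s 0%N) < +oo)%E -> 0 < e ->
  exists2 g, unif_continuous_on Omega g & (energy f g < e%:E)%E.
Proof.
move=> mf f_fin e0.
pose m := fine (mu Omega).
have mE : mu Omega = m%:E by rewrite fineK // ge0_fin_numE.
have m0 : 0 <= m by rewrite fine_ge0.
(* Chosen so that [c * m <= e / 3], also when [m] is 0; where the maps are within [eps], the
   integrand is at most [c]. *)
pose c := e / (3 * (m + 1)).
have c0 : 0 < c by rewrite divr_gt0 // mulr_gt0 // ltr_wpDl.
pose eps := c `^ p^-1.
have eps0 : 0 < eps by exact: powR_gt0.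
have epsp : eps `^ p = c by rewrite -powRrM mulVf ?powRr1 ?ltW // gt_eqF.
pose C i : set V := Omega `&` [set x | mdist (f x) (s i) < eps].
have mC i : measurable (C i).
  have mfi : measurable_fun (Omega : set V) (fun x => mdist (f x) (s i)).
    exact: (measurable_mdist_cst _ _ _ mO f (s i) mf).
  have -> : C i = Omega `&` (fun x => mdist (f x) (s i)) @^-1` `]-oo, eps[.
    by apply/seteqP; split=> x /=; rewrite in_itv.
  by apply: mfi => //; exact: measurable_itv.
(* The points that [f] sends to none of the first [k] balls; by density of [s] these sets decrease
   to the empty set. *)
pose B k : set V := Omega `&` \big[setI/setT]_(j < k) ~` C j.
have mB k : measurable (B k).
  apply: measurableI => //; elim/big_ind: _ => [|? ?|j _].
  - exact: measurableT.
  - exact: measurableI.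
  - exact: measurableC.
have BP k x : B k x <-> Omega x /\ forall j, (j < k)%N -> ~ C j x.
  rewrite /B -(bigcap_mkord k (fun j => ~` C j)); split=> -[Ox BC]; split=> //.
(* Here [i] is the first index with [f x] near [s i], which makes the sets disjoint. *)
pose A i := C i `&` B i.
have mA i : measurable (A i) by exact: measurableI.
have AO i : A i `<=` Omega by move=> x [[]].
pose h x := mdist (f x) (s 0%N) `^ p.
have h0 x : 0 <= h x by exact: powR_ge0.
have mcst a : borel_measurable Omega (fun=> a) by exact: measurable_cst.
have mh : measurable_fun (Omega : set V) h by exact: measurable_mdist_powR.
have ih : mu.-integrable Omega (EFin \o h).
  apply/integrableP; split; first exact/measurable_EFinP.
  by under eq_integral do rewrite /= ger0_norm //.
have e30 : 0 < e / 3 by rewrite divr_gt0.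
have [r r0 rP] := ge0_integral_abs_continuous _ _ _ _ _ _ _ mO ih h0 e30.
have [N BN] : exists N, (mu (B N) < r%:E)%E.
  apply: nonincreasing_measure_small => //.
  - by apply: le_lt_trans Ofin; apply: le_measure; rewrite ?inE //; exact: subIsetl.
  - move=> k x /BP[Ox BC]; apply/BP; split=> // j jk; apply: BC.
    exact: ltn_trans (ltnSn k).
  - rewrite -subset0 => x Bx; have /BP[Ox _] := Bx 0%N I.
    have [i fi] := s_dense (f x) _ eps0.
    by have /BP[_ /(_ i (ltnSn i))] := Bx i.+1 I; apply.
have [gamma [L [M [gL gM gs]]]] := geodesic_curve R H s N gH.
have M0 : 0 <= M by exact: le_trans (mdist_ge0 _ _) (gM 0).
pose K : R := 2 `^ p.
have K0 : 0 < K by exact: powR_gt0.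
(* [K] is the constant of [powRD_le]. On the exceptional set, [h] and the p-th power of [M] each
   receive [e / (6 * K)], which makes [e / 3] after multiplication by [K]. *)
have e60 : 0 < e / (6 * K) by rewrite divr_gt0 // mulr_gt0.
have [r' r'0 r'P] := ge0_integral_abs_continuous _ _ _ _ _ _ _ mO ih h0 e60.
have Mp0 : 0 <= M `^ p by exact: powR_ge0.
(* The first bound controls the integral of [h] over the exceptional set, the second its measure
   times the p-th power of [M]; the summand 1 covers [M = 0]. *)
pose eta := Num.min r' (e / (6 * K) / (M `^ p + 1)).
have eta0 : 0 < eta.
  by rewrite lt_min r'0 /= divr_gt0 // ltr_wpDl.
have [phi lphi [Bd [mBd Bdeta phiE]]] := lipschitz_approx_sum A N eta mA AO eta0.
exists (gamma \o phi); first exact: unif_continuous_lipschitz_comp gL lphi.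
have ug := unif_continuous_lipschitz_comp _ _ _ gL lphi.
have mg := unif_continuous_borel _ _ oO ug.
(* By the triangle inequality through [s 0], this bounds the integrand whatever the value of
   [phi]. *)
pose k x := K * (h x + M `^ p).
pose L' : set V := Omega `&` Bd.
have mL' : measurable L' by exact: measurableI.
have L'eta : (mu L' < eta%:E)%E.
  apply: le_lt_trans Bdeta; apply: le_measure; rewrite ?inE //.
  exact: subIsetr.
have BO : B N `<=` Omega by exact: subIsetl.
have L'O : L' `<=` Omega by exact: subIsetl.
have mk : measurable_fun (Omega : set V) k.
  exact: measurable_fun_affine.
have k0 x : 0 <= k x by rewrite mulr_ge0 ?addr_ge0 // ltW.
apply: (@le_lt_trans _ _ (c%:E * mu Omega + \int[mu]_(x in B N) (h x)%:E
    + \int[mu]_(x in L') (k x)%:E)%E).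
  have mu_ := measurable_mdist_powR f (gamma \o phi) mf mg.
  have u0 x : 0 <= mdist (f x) ((gamma \o phi) x) `^ p by exact: powR_ge0.
  apply: (ge0_integral_le_pieces _ _ _ _ _ _ _ _ _ _ _
    mO (mB N) mL' BO L'O mu_ mh mk (ltW c0) u0 h0 k0).
  move=> x Ox.
    have [Bdx|Bdx] := pselect (Bd x).
      apply: Or33; split; first by [].
      apply: le_trans (powRD_le _ _ _ _ (ltW p_gt0) (mdist_ge0 _ _) _) => //.
      apply: ge0_ler_powR; rewrite ?nnegrE ?addr_ge0 ?mdist_ge0 ?(ltW p_gt0) //.
      apply: le_trans (metric_triangle _ (s 0%N) _) _; rewrite lerD2l.
      exact: gM.
    have [BNx|nBNx] := pselect (B N x).
      (* All indicators vanish at [x], so [phi x = 0], and [gamma] takes the value [s 0] there: the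
         integrand is [h x]. *)
      apply: Or32; split=> //; rewrite /= phiE // big1 ?(gs 0%N) // => i _.
      rewrite indicE memNset ?mulr0 // => -[Cix _].
      by have /BP[_ /(_ i (ltn_ord i))] := BNx.
    apply: Or31; rewrite -epsp; apply: ge0_ler_powR;
      rewrite ?nnegrE ?mdist_ge0 ?(ltW p_gt0) ?(ltW eps0) //.
    (* The least such index is the only one whose [A i] contains [x], so the sum reduces to this
       index. *)
    have exC : exists i, (i < N)%N && `[< C i x >].
      apply: contrapT => nC; apply: nBNx; apply/BP; split=> // j jN Cjx.
      by apply: nC; exists j; rewrite jN; exact/asboolP.
    have [i /andP[iN /asboolP Cix] imin] := ex_minnP exC.
    have phix : phi x = i%:R.
      rewrite phiE // (bigD1 (Ordinal iN)) //= big1 => [|j ji].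
        rewrite addr0 indicE mem_set ?mulr1 //; split=> //; apply/BP; split=> // j ji.
        move=> /asboolP Cjx; have := imin j.
        by rewrite (ltn_trans ji iN) Cjx leqNgt ji => /(_ isT).
      rewrite indicE memNset ?mulr0 // => -[Cjx /BP[_ BC]].
      have := imin j; rewrite ltn_ord asboolT // => /(_ isT).
      rewrite leq_eqVlt => /orP[/eqP ij|/BC//].
      by move/eqP: ji; apply; apply: val_inj.
    by rewrite /= phix gs ?(ltnW iN) //; case: Cix => _ /ltW.
have cm : c * m <= e / 3.
  have m1 : 0 < m + 1 by rewrite ltr_wpDl.
  have -> : c * m = e / 3 * (m / (m + 1)) by rewrite /c; field; rewrite gt_eqF.
  apply: ler_piMr; first exact: ltW.
  by rewrite ler_pdivrMr // mul1r lerDl.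
have hL' : (\int[mu]_(x in L') (h x)%:E < (e / (6 * K))%:E)%E.
  apply: r'P => //; apply: lt_le_trans L'eta _.
  by rewrite lee_fin /eta ge_min lexx.
have mhL' : measurable_fun L' h by exact: measurable_funS mh.
have kL' : (\int[mu]_(x in L') (k x)%:E < (e / 3)%:E)%E.
  apply: (@le_lt_trans _ _ (K%:E * (\int[mu]_(x in L') (h x)%:E +
      \int[mu]_(x in L') (M `^ p)%:E))%E).
    have mML' : measurable_fun L' (fun=> M `^ p) by exact: measurable_cst.
    apply: (ge0_integral_le_combination _ _ _ _ _ _ _ _ _ mL' mhL' mML') => //.
    - exact: measurable_fun_affine.
    - exact: ltW.
  rewrite integral_cst //.
  have ML' : ((M `^ p)%:E * mu L' <= (e / (6 * K))%:E)%E.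
    apply: (@le_trans _ _ ((M `^ p)%:E * eta%:E)%E).
      by apply: lee_wpmul2l; [rewrite lee_fin|exact: ltW].
    rewrite -EFinM lee_fin.
    apply: (@le_trans _ _ (M `^ p * (e / (6 * K) / (M `^ p + 1)))).
      by apply: ler_wpM2l => //; rewrite /eta ge_min lexx orbT.
    rewrite mulrCA; apply: ler_piMr; first exact: ltW.
    by rewrite ler_pdivrMr ?mul1r ?lerDl // ltr_wpDl.
  have -> : (e / 3)%:E = (K%:E * ((e / (6 * K))%:E + (e / (6 * K))%:E))%E.
    by rewrite -EFinD -EFinM; congr EFin; field; rewrite gt_eqF.
  rewrite lte_pmul2l ?lte_fin //; apply: lte_leD => //.
  by rewrite fin_numM // ge0_fin_numE // (lt_trans L'eta) // ltry.
rewrite [ltRHS](_ : _ = ((e / 3)%:E + (e / 3)%:E + (e / 3)%:E)%E); last first.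
  by rewrite -!EFinD; congr EFin; field.
apply: lteD kL' => //; apply: lee_ltD => //.
- by rewrite mE.
- by rewrite mE -EFinM lee_fin.
- by apply: rP.
Qed.

End energy.

(** * Passage to the classes of [L^p] *)

Lemma unif_continuous_calLp (R : realType) (n : nat) (H : completeMetricType R)
    (p : R) (Omega : set 'rV[R]_n) (g : 'rV[R]_n -> H) :
  0 < p -> open Omega -> bounded_set Omega ->
  unif_continuous_on Omega g -> calLp p Omega g.
Proof.
move=> p0 oO bO ug; have mg := unif_continuous_borel _ _ oO ug.
split=> // a; apply: poweR_lty.
have [M gM] := unif_continuous_bounded _ g a bO ug.
have mO := open_lebesgue_measurable _ oO.
(* The absolute value is taken because [M] may be negative when [Omega] is empty. *)
apply: (@le_lt_trans _ _ ((`|M| `^ p)%:E * lebesgue_measure_rV Omega)%E); last first.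
  by rewrite lte_mul_pinfty ?lee_fin ?powR_ge0 //; exact: bounded_set_lebesgue_fin.
rewrite -integral_cst //; apply: ge0_le_integral => //.
- by move=> x _; rewrite lee_fin powR_ge0.
- apply/measurable_EFinP; apply: (measurableT_comp (measurable_powR p)).
  exact: (measurable_mdist_cst _ _ _ mO g a mg).
- move=> x Ox; rewrite lee_fin.
  apply: ge0_ler_powR; rewrite ?nnegrE ?mdist_ge0 ?(ltW p0) //.
  exact: le_trans (gM x Ox) (ler_norm M).
Qed.

Theorem theorem2p2 (R : realType) (n : nat) (n_ge2 : (2 <= n)%N)
    (Omega : set 'rV[R]_n)
    (Omega_open : open Omega) (Omega_bounded : bounded_set Omega)
    (Omega_connected : connected Omega)
    (Omega_lipschitz : lipschitz_boundary Omega)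
    (H : completeMetricType R) (H_hadamard : hadamard_space H)
    (H_locally_compact : locally_compact [set: H])
    (p : R) (p_ge1 : 1 <= p) :
  dense_in_Lp p Omega (@unif_continuous_on R n H Omega).
Proof.
have p0 : 0 < p by exact: lt_le_trans p_ge1.
have [gH _] := H_hadamard.
split=> [g|_ [f [mf f_fin] <-] e e0]; first exact: unif_continuous_calLp.
have [D cD DT] := locally_compact_geodesic_separable (f 0) gH H_locally_compact.
have [s s_dense] := separable_dense_sequence _ _ _ (f 0) cD DT.
have pV0 : p^-1 != 0 by rewrite invr_eq0 gt_eqF.
have energy_eq0 (u v : _ -> H) : dp p Omega u v = 0%E -> energy p Omega u v = 0%E.
  by move/poweR_eq0_eq0; apply; exact: energy_ge0.
pose K : R := 2 `^ p.
have K0 : 0 < K by exact: powR_gt0.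
(* The triangle inequality is used twice, from [f'] through [f] to [g'] and from [f] through [g] to
   [g'], each time with a factor [K]. *)
have c0 : 0 < e `^ p / (K * K) by rewrite divr_gt0 ?powR_gt0 ?mulr_gt0.
have [|g ug fg] := energy_dense p Omega s p0 Omega_open Omega_bounded s_dense
    f _ gH mf _ c0.
  exact: lty_poweRy pV0 (f_fin (s 0%N)).
have cg := unif_continuous_calLp _ _ _ _ _ _ p0 Omega_open Omega_bounded ug.
exists (Lp_class p Omega g); split; last by exists g.
split=> [|f' g' [[mf' _] ff'] [[mg' _] gg']]; first by exists g.
have [mg _] := cg.
have tri := energy_triangle p Omega s p0 Omega_open s_dense.
have E_lt : (energy p Omega f' g' < (e `^ p)%:E)%E.
  apply: le_lt_trans (tri f' f g' mf' mf mg') _.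
  rewrite energy_sym (energy_eq0 f f' ff') add0e.
  apply: (@le_lt_trans _ _ (K%:E * (K%:E * energy p Omega f g))%E).
    apply: lee_wpmul2l; first by rewrite lee_fin ltW.
    by apply: le_trans (tri f g g' mf mg mg') _; rewrite (energy_eq0 g g' gg') adde0.
  have -> : (e `^ p)%:E = (K%:E * (K%:E * (e `^ p / (K * K))%:E))%E.
    by rewrite -!EFinM; congr EFin; field; rewrite gt_eqF.
  by rewrite !lte_pmul2l ?lte_fin.
rewrite /dp -/(energy p Omega f' g').
have := energy_ge0 p Omega f' g'; move: E_lt.
(* The energy is finite and below the p-th power of [e]; taking roots gives the bound on [dp]. *)
case: (energy p Omega f' g') => [x| |] //; rewrite lte_fin lee_fin => xe x0.
have ep : (e `^ p) `^ p^-1 = e.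
  by rewrite -powRrM mulfV ?gt_eqF // powRr1 // ltW.
rewrite poweR_EFin lte_fin -[ltRHS]ep.
by apply: gt0_ltr_powR; rewrite ?nnegrE ?powR_ge0 ?invr_gt0.
Qed.
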